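(* Let $\mathcal{G}$ be a directed graph with $n$ vertices, $m$ edges and incidence matrix $B\in\mathbb{R}^{n\times m}$. Let $u^-,u^+\in\mathbb{R}^m$ satisfy $u_i^-<0<u_i^+$ for $i=1,\ldots,m$ (every edge allows bi-directional flow). Let $H:\mathbb{R}^n\to\mathbb{R}$ be twice continuously differentiable with positive definite Hessian matrix at every point, and let $E\in\mathbb{R}^{n\times k}$ satisfy $\operatorname{im}E\subset\operatorname{im}B$. Then for any in/outflow $\bar d\in\mathbb{R}^k$ for which there exists $\bar x_c\in\mathcal{P}(u^-,u^+)$ such that $E\bar d=B\bar x_c$, the trajectories of $$\dot x = B\,\mathrm{sat}\Big(-B^T\frac{\partial H}{\partial x}(x)-x_c\,;u^-,u^+\Big)+E\bar d,\qquad \dot x_c=B^T\frac{\partial H}{\partial x}(x)$$ ($x\in\mathbb{R}^n$, $x_c\in\mathbb{R}^m$) converge to the set $$\mathcal{E}_{\mathrm{tot}}=\Big\{(x,x_c)\ \Big|\ \frac{\partial H}{\partial x}(x)=\alpha\mathds{1}\ \text{for some }\alpha\in\mathbb{R},\ B\,\mathrm{sat}(-x_c\,;u^-,u^+)+E\bar d=0\Big\}$$ if and only if the graph $\mathcal{G}$ is weakly connected.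
   Context: A directed graph consists of a finite set of vertices and a finite set of edges, together with a map assigning to each edge an ordered pair $(v,w)$ of distinct vertices (tail $v$, head $w$); no self-loops are allowed. Its incidence matrix $B$ is the $n\times m$ matrix whose $(i,j)$ entry is $1$ if vertex $i$ is the head of edge $j$, $-1$ if vertex $i$ is the tail of edge $j$, and $0$ otherwise. The graph is weakly connected if any vertex can be reached from every other vertex using the edges without taking into account their direction. $\frac{\partial H}{\partial x}(x)$ is the gradient (column vector) of $H$; $\mathds{1}$ is the vector with all entries $1$. For $a,b\in\mathbb{R}^m$ with $a_i<b_i$ for all $i$, $\mathrm{sat}(x;a,b)\in\mathbb{R}^m$ is defined by $\mathrm{sat}(x;a,b)_i=a_i$ if $x_i\le a_i$, $=x_i$ if $a_i<x_i<b_i$, $=b_i$ if $x_i\ge b_i$. The permission set is $\mathcal{P}(u^-,u^+)=\mathcal{P}_1(u^-,u^+)\times\cdots\times\mathcal{P}_m(u^-,u^+)$, where (for $u_i^-<0<u_i^+$) $\mathcal{P}_i(u^-,u^+)$ is the open interval $(u_i^-,-u_i^-)$ if $|u_i^-|\le|u_i^+|$, and $(-u_i^+,u_i^+)$ if $|u_i^-|>|u_i^+|$. ''Trajectories converge to a set'' means that for every initial condition in $\mathbb{R}^n\times\mathbb{R}^m$ the solution's distance to the set tends to $0$ as $t\to\infty$.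
   Formalization: The set E_tot is assumed nonempty; without this the claim fails: for one edge, E = 0 and H = exp(x1−x2)+(x1+x2)^2 the Hessian is positive definite and the graph connected, but no gradient is a multiple of the all-ones vector, so E_tot is empty. *)

(* Defs.v *)
(* MathComp / MathComp-Analysis. Vectors of R^n are column vectors 'cV[R]_n. *)
From HB Require Import structures.
From mathcomp Require Import all_boot all_order all_algebra.
From mathcomp Require Import all_classical all_reals all_analysis.

Set Implicit Arguments.
Unset Strict Implicit.
Unset Printing Implicit Defensive.

Import Order.TTheory GRing.Theory Num.Theory.
Import numFieldNormedType.Exports.

Local Open Scope classical_set_scope.
Local Open Scope ring_scope.

(* Parallel and antiparallel edges are allowed, self-loops are not. *)
Record digraph (n m : nat) := Digraph {
  tail : 'I_m -> 'I_n;
  head : 'I_m -> 'I_n;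
  tail_neq_head : forall j, tail j != head j
}.

Definition incidence (R : realType) n m (G : digraph n m) : 'M[R]_(n, m) :=
  \matrix_(i, j) (if i == head G j then 1 else if i == tail G j then -1 else 0).

Definition adjacent n m (G : digraph n m) : rel 'I_n :=
  [rel v w | [exists j, ((tail G j == v) && (head G j == w))
                     || ((tail G j == w) && (head G j == v))]].

Definition weakly_connected n m (G : digraph n m) : Prop :=
  forall v w : 'I_n, connect (adjacent G) v w.

Section Calculus.
Context {R : realType} {n : nat}.
Implicit Types (H : 'cV[R]_n -> R) (x : 'cV[R]_n).

Definition gradient H x : 'cV[R]_n :=
  \col_i 'D_(delta_mx i 0) H x.

Definition hessian H x : 'M[R]_n :=
  \matrix_(i, j) 'D_(delta_mx j 0) (fun y => gradient H y i 0) x.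

(* Twice Frechet differentiable, with continuous second derivative. *)
Definition twice_continuously_differentiable H : Prop :=
  [/\ forall x, differentiable H x,
      forall x, differentiable (gradient H) x &
      continuous (hessian H)].

(* Symmetry is not part of the definition: it is only used for Hessians of
   twice continuously differentiable functions, which are symmetric. *)
Definition positive_definite (M : 'M[R]_n) : Prop :=
  forall v : 'cV[R]_n, v != 0 -> 0 < (v^T *m M *m v) 0 0.

End Calculus.

Definition sat (R : realType) m (x a b : 'cV[R]_m) : 'cV[R]_m :=
  \col_i (if x i 0 <= a i 0 then a i 0
          else if x i 0 < b i 0 then x i 0
          else b i 0).

Definition permission_interval (R : realType) (um up : R) : interval R :=
  if `|um| <= `|up| then `]um, - um[ else `]- up, up[.

Definition permission_set (R : realType) m (um up : 'cV[R]_m) : set 'cV[R]_m :=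
  [set x | forall i, x i 0 \in permission_interval (um i 0) (up i 0)].

Section ClosedLoop.
Context {R : realType} {n m k : nat}.
Variables (G : digraph n m) (um up : 'cV[R]_m) (H : 'cV[R]_n -> R).
Variables (E : 'M[R]_(n, k)) (d : 'cV[R]_k).

Let B := incidence R G.

(* x and xc solve the closed-loop system on [0, +oo[ from (x0, xc0): they are
   continuous there and satisfy the differential equations on ]0, +oo[ (by
   continuity of the vector field, the one-sided derivatives at 0 then exist
   and satisfy them too). Values at negative times are irrelevant. *)
Definition is_trajectory (x0 : 'cV[R]_n) (xc0 : 'cV[R]_m)
    (x : R -> 'cV[R]_n) (xc : R -> 'cV[R]_m) : Prop :=
  [/\ x 0 = x0 /\ xc 0 = xc0,
      {within `[0, +oo[, continuous x},
      {within `[0, +oo[, continuous xc} &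
      forall t : R, 0 < t ->
        is_derive t 1 x
          (B *m sat (- (B^T *m gradient H (x t)) - xc t) um up + E *m d) /\
        is_derive t 1 xc (B^T *m gradient H (x t))].

(* Positive definiteness of the Hessian does not make E_tot nonempty: for
   H = exp (x1 - x2) + (x1 + x2)^2 no gradient is a multiple of (1, 1). *)
Definition E_tot : set ('cV[R]_n * 'cV[R]_m) :=
  [set z | (exists alpha : R, gradient H z.1 = const_mx alpha) /\
           B *m sat (- z.2) um up + E *m d = 0].

(* edist_inf A z is the distance from z to A, for the sup norm; it is +oo if
   A is empty. *)
Definition trajectories_converge_to (A : set ('cV[R]_n * 'cV[R]_m)) : Prop :=
  forall (x0 : 'cV[R]_n) (xc0 : 'cV[R]_m) x xc, is_trajectory x0 xc0 x xc ->
    edist_inf A (x t, xc t) @[t --> +oo] --> 0%E.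

End ClosedLoop.

(* Main.v *)
(* Write c for the steady flow [xcbar], q = sat(-x_c), r = sat(-B^T grad H(x) - x_c)
   and y = B^T grad H(x); then x' = B (r + c), x_c' = y, and the two conditions
   defining E_tot are B (q + c) = 0 and, on a connected graph, y = 0.

   Sufficiency. Let (xs, _) be a point of E_tot. Let V be the excess of H over
   its tangent plane at xs, which is coercive by convexity, plus the integrals of
   sat(u_j) + c_j over u_j up to -x_c,j; these are coercive because -c lies
   strictly between the bounds. Since grad H(xs) is constant and 1^T B = 0, the
   derivative of V is -W with W = sum_j y_j (q_j - r_j) >= 0, so orbits are
   bounded and W -> 0 by Barbalat's lemma. This gives r - q -> 0, and y_j -> 0
   wherever q_j is away from its bounds. Instead of an invariance principle, call
   h slowly varying if h(t + s) - h(t) -> 0 uniformly for s in bounded intervals;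
   a bounded function with slowly varying derivative has derivative tending to 0.
   Here q is slowly varying, hence so is x', so x' -> 0; then y is slowly varying
   and it is the derivative of the bounded x_c, so y -> 0. Compactness turns
   this into convergence of the distance to E_tot.

   Necessity. If the graph is disconnected, coercivity of the excess survives a
   small linear perturbation, so grad H takes a value which is constant on each
   connected component but not globally. This is an equilibrium outside the
   closed set E_tot. *)
Require Import Defs.
From HB Require Import structures.
From mathcomp Require Import all_boot all_order all_algebra.
From mathcomp Require Import all_classical all_reals all_analysis.
From mathcomp Require Import ring lra.

Set Implicit Arguments.
Unset Strict Implicit.
Unset Printing Implicit Defensive.

Import Order.TTheory GRing.Theory Num.Theory.
Import numFieldNormedType.Exports.

Local Open Scope classical_set_scope.
Local Open Scope ring_scope.

(** * Scalar saturation: estimates for [clamp] and two auxiliary primitives *)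

Section Clamp.
Context {R : realType} (a b : R).
Implicit Types u v y c : R.

Definition clamp u : R := if u <= a then a else if u < b then u else b.

Lemma clamp_itv (ab : a < b) u : a <= clamp u <= b.
Proof.
rewrite /clamp; case: (leP u a) => ?; [|case: (ltP u b) => ?];
  by apply/andP; split; lra.
Qed.

Lemma clamp_mono_lipschitz (ab : a < b) u v : u <= v -> 0 <= clamp v - clamp u <= v - u.
Proof.
move=> uv; rewrite /clamp.
case: (leP u a) => ?; case: (leP v a) => ?; case: (ltP u b) => ?;
  case: (ltP v b) => ?; apply/andP; split; lra.
Qed.

Lemma clamp_lipschitz (ab : a < b) u v : `|clamp u - clamp v| <= `|u - v|.
Proof.
wlog uv : u v / u <= v.
  by move=> H; case/orP: (le_total u v) => /H //; rewrite distrC (distrC u).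
have /andP[c0 c1] := clamp_mono_lipschitz ab uv.
by rewrite distrC (distrC u) !ger0_norm ?subr_ge0 // -subr_ge0.
Qed.

(** For [a < b] this is the convex conjugate of [p ^+ 2 / 2] restricted to [[a, b]], that is, the
    maximum over that interval of [p * u - p ^+ 2 / 2], attained at [p = clamp u]. *)
Definition clamp_primitive u : R := u * clamp u - clamp u ^+ 2 / 2.

(** The quadratic remainder is valid across the kinks of [clamp], so it gives the derivative of
    [clamp_primitive] at every point at once. *)
Lemma clamp_primitive_tangent (ab : a < b) u v :
  0 <= clamp_primitive v - clamp_primitive u - clamp u * (v - u) <= (v - u) ^+ 2.
Proof.
have := sqr_ge0 (v - u); rewrite /clamp_primitive /clamp.
by case: (leP u a) => ?; case: (leP v a) => ?; case: (ltP u b) => ?;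
  case: (ltP v b) => ? ?; apply/andP; split; nra.
Qed.

Lemma clamp_primitive_ge p u : a <= p <= b -> p * u - p ^+ 2 / 2 <= clamp_primitive u.
Proof.
move=> /andP[ap pb]; rewrite /clamp_primitive /clamp.
case: (leP u a) => ua; [|case: (ltP u b) => ub].
- have := mulr_ge0 (_ : 0 <= p - a) (_ : 0 <= a - u); have := sqr_ge0 (p - a); nra.
- have := sqr_ge0 (p - u); nra.
- have := mulr_ge0 (_ : 0 <= b - p) (_ : 0 <= u - b); have := sqr_ge0 (p - b); nra.
Qed.

(* The primitive of [(r - a) (b - r)]; this weight vanishes at both ends of
   [[a, b]], hence [clamp_cubic \o clamp] is C^1 although [clamp] is not. *)
Definition clamp_cubic c : R := - c ^+ 3 / 3 + (a + b) * c ^+ 2 / 2 - a * b * c.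

Lemma clamp_cubic_tangent (ab : a < b) u v :
  `|clamp_cubic (clamp v) - clamp_cubic (clamp u)
    - (clamp u - a) * (b - clamp u) * (v - u)| <= 2 * (b - a) * (v - u) ^+ 2.
Proof.
set c := clamp u; set d := clamp v.
(* The first term is the Taylor remainder of the cubic between [c] and [d], the second the weighted
   mismatch between the clamped and the unclamped increment. *)
rewrite (_ : _ - _ - _ = (d - c) ^+ 2 * ((a + b) / 2 - (2 * c + d) / 3)
    + (c - a) * (b - c) * (d - c - (v - u))); last by rewrite /clamp_cubic; field.
have /andP[ac cb] : a <= c <= b := clamp_itv ab u.
have /andP[ad db] : a <= d <= b := clamp_itv ab v.
rewrite (le_trans (ler_normD _ _)) // (_ : 2 * _ * _ = (b - a) * (v - u) ^+ 2
  + (b - a) * (v - u) ^+ 2) ?lerD //; last by ring.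
  rewrite normrM mulrC ler_pM // ?normr_ge0 //.
    by rewrite ler_norml; apply/andP; split; lra.
  rewrite normrX -[leRHS]real_normK ?num_real // lerXn2r ?nnegrE //.
  exact: clamp_lipschitz.
(* Meant for [v] outside [[a, b]]: [p] and [q] are the distances from [u] to the end crossed and to
   the other end, and [r] is the overshoot of [v]. Then [p + q = b - a], and [p + r] is the distance
   from [u] to [v]. *)
have key (p q r : R) : 0 <= p -> 0 <= q -> 0 <= r ->
    p * q * r <= (p + q) * (p + r) ^+ 2.
  move=> p0 q0 r0; rewrite -subr_ge0.
  rewrite (_ : _ - _ = p * (p + r) ^+ 2 + q * (p ^+ 2 + p * r + r ^+ 2)); last by ring.
  by rewrite ?(addr_ge0, mulr_ge0, sqr_ge0).
rewrite {}/c {}/d in ac cb ad db *; rewrite /clamp.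
have rhs0 : 0 <= (b - a) * (v - u) ^+ 2 by rewrite mulr_ge0 ?sqr_ge0 // subr_ge0 ltW.
case: (leP u a) => [_|ua]; first by rewrite subrr !mul0r normr0.
case: (ltP u b) => [ub|_]; last by rewrite subrr mulr0 mul0r normr0.
case: (leP v a) => [va|av].
  have := key (u - a) (b - u) (a - v); rewrite !subr_ge0 => /(_ (ltW ua) (ltW ub) va) h.
  rewrite ger0_norm; last by rewrite !mulr_ge0 //; lra.
  by nra.
case: (ltP v b) => [vb|bv]; first by rewrite subrr mulr0 normr0.
have := key (b - u) (u - a) (v - b); rewrite !subr_ge0 => /(_ (ltW ub) (ltW ua) bv) h.
rewrite ler0_norm; first by nra.
by rewrite mulr_ge0_le0 ?mulr_ge0 //; lra.
Qed.

(** On [[c, c']] the weight [(r - a) * (b - r)] dominates [(r - c) * (c' - r)], whose integral is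
    the left-hand side. Hence a small increment of [clamp_cubic] forces a small increment of its
    argument. *)
Lemma clamp_cubic_incr c c' : a <= c -> c <= c' -> c' <= b ->
  (c' - c) ^+ 3 / 6 <= clamp_cubic c' - clamp_cubic c.
Proof.
move=> ac cc cb; rewrite /clamp_cubic.
set p := c - a; set h := c' - c; set q := b - c'.
have p0 : 0 <= p by rewrite subr_ge0.
have h0 : 0 <= h by rewrite subr_ge0.
have q0 : 0 <= q by rewrite subr_ge0.
rewrite -subr_ge0.
rewrite [leRHS](_ : _ = p * q * h + (p + q) * h ^+ 2 / 2); last first.
  by rewrite /p /q /h; field.
move: p q h p0 q0 h0 => p q h p0 q0 h0.
by rewrite ?(addr_ge0, mulr_ge0, sqr_ge0, invr_ge0).
Qed.

(** Since [clamp] is nondecreasing and 1-Lipschitz, its increment has the sign of [y] and is at most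
    as large. *)
Lemma clamp_dissipation (ab : a < b) u y :
  (clamp u - clamp (u - y)) ^+ 2 <= y * (clamp u - clamp (u - y)).
Proof.
rewrite expr2; case: (leP 0 y) => y0.
  have /andP[? ?] : 0 <= clamp u - clamp (u - y) <= u - (u - y).
    by apply: clamp_mono_lipschitz; lra.
  by nra.
have /andP[? ?] : 0 <= clamp (u - y) - clamp u <= u - y - u.
  by apply: clamp_mono_lipschitz; lra.
by nra.
Qed.

(** When [u] is saturated, [w] gives no control of [y]; the weight vanishes there, so the weighted
    [y] is still small with [w]. The square root comes from the unsaturated case [w = y ^+ 2]. *)
Lemma clamp_dissipation_weight (ab : a < b) u y w :
  w = y * (clamp u - clamp (u - y)) ->
  `|(clamp u - a) * (b - clamp u) * y| <= (b - a) * w + (b - a) ^+ 2 * Num.sqrt w.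
Proof.
move=> wE.
have w0 : 0 <= w by rewrite wE (le_trans (sqr_ge0 _) (clamp_dissipation ab u y)).
have L0 : 0 <= b - a by rewrite subr_ge0 ltW.
have R0 : 0 <= (b - a) * w + (b - a) ^+ 2 * Num.sqrt w.
  by rewrite addr_ge0 ?mulr_ge0 ?sqr_ge0 ?sqrtr_ge0.
have [/andP[ua ub]|out] := boolP (a < u < b); last first.
  suff -> : (clamp u - a) * (b - clamp u) = 0 by rewrite mul0r normr0.
  move: out; rewrite /clamp negb_and -!leNgt; case: (leP u a) => /= [_ _|_ ub].
    by rewrite subrr mul0r.
  by rewrite ltNge ub /= subrr mulr0.
have cu : clamp u = u by rewrite /clamp leNgt ua /= ub.
(* Either [u - y] is still unsaturated and [w = y^2], or it is saturated and
   [w] is [`|y|] times the distance of [u] to the end it has crossed. *)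
have [[ay yb]|[[ya]|by_]] : (a < u - y /\ u - y < b) \/ (u - y <= a \/ b <= u - y).
  by case: (leP (u - y) a); case: (ltP (u - y) b); auto.
- have we : w = y ^+ 2 by rewrite wE cu {1}/clamp leNgt ay /= yb; ring.
  rewrite we sqrtr_sqr cu (le_trans (_ : _ <= (b - a) ^+ 2 * `|y|)) //; last first.
    by rewrite lerDr mulr_ge0 ?sqr_ge0.
  rewrite normrM ler_wpM2r // ger0_norm ?mulr_ge0 ?subr_ge0 ?(ltW ua) ?(ltW ub) //.
  by nra.
- have we : w = y * (u - a) by rewrite wE cu {1}/clamp ya.
  rewrite cu (le_trans (_ : _ <= (b - a) * w)) ?lerDl ?mulr_ge0 ?sqr_ge0 ?sqrtr_ge0 //.
  rewrite we ger0_norm; last by rewrite !mulr_ge0; lra.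
  rewrite [leLHS](_ : _ = (b - u) * (y * (u - a))); last by ring.
  by rewrite ler_wpM2r ?mulr_ge0; lra.
- have we : w = - y * (b - u).
    by rewrite wE cu {1}/clamp leNgt (lt_le_trans ab by_) /= ltNge by_ /=; ring.
  rewrite cu (le_trans (_ : _ <= (b - a) * w)) ?lerDl ?mulr_ge0 ?sqr_ge0 ?sqrtr_ge0 //.
  rewrite we ler0_norm; last by rewrite mulr_ge0_le0 ?mulr_ge0; lra.
  rewrite [leLHS](_ : _ = (u - a) * (- y * (b - u))); last by ring.
  by rewrite ler_wpM2r ?mulr_ge0; lra.
Qed.

End Clamp.

(** * Asymptotics of scalar functions: slow variation and Barbalat's lemma *)

Section SlowVariation.
Context {R : realType}.
Implicit Types (f g h W : R -> R) (t s T e M : R).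

Definition slowly_varying h := forall T e, 0 < e ->
  \forall t \near +oo, forall s, 0 <= s <= T -> `|h (t + s) - h t| <= e.

Lemma near_pinfty_shift (P : R -> Prop) :
  (\forall t \near +oo, P t) -> \forall t \near +oo, forall s, 0 <= s -> P (t + s).
Proof.
move=> [M [Mr MP]]; exists M; split=> // t Mt s s0.
by apply: MP; rewrite (lt_le_trans Mt) // lerDl.
Qed.

Lemma cvg0_pinftyP h :
  h t @[t --> +oo] --> (0 : R) <->
  forall e, 0 < e -> \forall t \near +oo, `|h t| <= e.
Proof.
split=> [/cvgrPdist_le h0 e e0|h0].
  by apply: filterS (h0 e e0) => t; rewrite sub0r normrN.
apply/cvgrPdist_le => e e0.
by apply: filterS (h0 e e0) => t; rewrite sub0r normrN.
Qed.

Lemma cvg0_sum (I : finType) (f : I -> R -> R) :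
  (forall i, f i t @[t --> +oo] --> (0 : R)) ->
  \sum_i f i t @[t --> +oo] --> (0 : R).
Proof.
move=> f0; rewrite [X in _ --> X](_ : _ = \sum_(i : I) (0 : R)); last by rewrite big1.
by apply: cvg_big => [|i _]; [exact: add_continuous|exact: f0].
Qed.

Lemma is_derive_MVT f f' t s : t <= s ->
    (forall u, t <= u <= s -> is_derive u 1 f (f' u)) ->
  exists2 c, t <= c <= s & f s - f t = f' c * (s - t).
Proof.
move=> ts df; apply: (MVT_segment ts) => [c cts|].
  by apply: df; rewrite !ltW ?(itvP cts).
apply: derivable_within_continuous => c; rewrite in_itv /= => /df [].
by [].
Qed.

Lemma is_derive_increment f f' t s :
    (forall t, 0 < t -> is_derive t 1 f (f' t)) -> 0 < t -> 0 <= s ->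
  exists2 c, t <= c & c <= t + s /\ f (t + s) - f t = f' c * s.
Proof.
move=> df t0 s0; have ts : t <= t + s by rewrite lerDl.
have [|c /andP[tc cs] ->] := @is_derive_MVT f f' t (t + s) ts.
  by move=> u /andP[tu _]; apply: df; exact: lt_le_trans tu.
by exists c => //; split=> //; rewrite addrAC subrr add0r.
Qed.

Lemma slowly_varying_cvg0 h : h t @[t --> +oo] --> (0 : R) -> slowly_varying h.
Proof.
move=> /cvg0_pinftyP h0 T e e0.
have /near_pinfty_shift hs := h0 _ (divr_gt0 e0 (ltr0n R 2)).
apply: filterS hs => t ht s /andP[s0 _].
have := ht 0 (lexx 0); have := ht s s0; rewrite addr0 => h1 h2.
by rewrite (le_trans (ler_normB _ _)) // (splitr e) lerD.
Qed.

Lemma slowly_varying_ext f h : (forall t, 0 < t -> f t = h t) ->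
  slowly_varying f -> slowly_varying h.
Proof.
move=> fh sf T e e0; have := sf T e e0; apply: filter_app.
near=> t => ht s /andP[s0 sT].
have t0 : 0 < t by near: t; exact: nbhs_pinfty_gt.
rewrite -!fh // ?ht ?s0 //.
by rewrite (lt_le_trans t0) // lerDl.
Unshelve. all: by end_near. Qed.

Lemma slowly_varyingD f g :
  slowly_varying f -> slowly_varying g -> slowly_varying (fun t => f t + g t).
Proof.
move=> sf sg T e e0; have e2 := divr_gt0 e0 (ltr0n R 2).
apply: filterS2 (sf T _ e2) (sg T _ e2) => t ft gt s sT.
rewrite opprD addrACA (le_trans (ler_normD _ _)) // (splitr e) lerD ?ft ?gt //.
Qed.

Lemma slowly_varyingZ (k : R) f :
  slowly_varying f -> slowly_varying (fun t => k * f t).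
Proof.
move=> sf T e e0.
have k0 : 0 < `|k| + 1 by rewrite ltr_wpDl.
apply: filterS (sf T _ (divr_gt0 e0 k0)) => t ft s /ft h.
rewrite -mulrBr normrM -(@divfK _ (`|k| + 1) _ e) ?gt_eqF // mulrC.
by rewrite ler_pM // lerDl.
Qed.

Lemma slowly_varying_sum (I : finType) (f : I -> R -> R) :
  (forall i, slowly_varying (f i)) -> slowly_varying (fun t => \sum_i f i t).
Proof.
move=> sf.
suff H (r : seq I) : slowly_varying (fun t => \sum_(i <- r) f i t) by exact: H.
elim: r => [|i r IH].
  by apply: slowly_varying_cvg0; under eq_fun do rewrite big_nil; exact: cvg_cst.
under eq_fun do rewrite big_cons.
exact: slowly_varyingD.
Qed.

(** Uniform continuity is expressed through increments, which covers both a continuous function of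
    an orbit in a compact set and the inversion of [clamp_cubic]. Times start at 1, where the bounds
    on orbits begin. *)
Lemma slowly_varying_uniform (I : finType) (f : I -> R -> R) (h : R -> R) :
    (forall e, 0 < e -> exists2 r, 0 < r & forall t s, 1 <= t -> 0 <= s ->
       (forall i, `|f i (t + s) - f i t| <= r) -> `|h (t + s) - h t| <= e) ->
    (forall i, slowly_varying (f i)) -> slowly_varying h.
Proof.
move=> uh sf T e /uh[r r0 rh].
have : \forall t \near +oo, forall i, forall s, 0 <= s <= T ->
    `|f i (t + s) - f i t| <= r.
  by apply: filter_forall => i; exact: sf.
apply: filter_app; near=> t => ft s /[dup] sT /andP[s0 _]; apply: rh => //.
by move=> i; exact: ft.
Unshelve. all: by end_near. Qed.

Lemma slowly_varying_derive h h' :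
    (forall t, 0 < t -> is_derive t 1 h (h' t)) ->
    h' t @[t --> +oo] --> (0 : R) -> slowly_varying h.
Proof.
move=> dh /cvg0_pinftyP h0 T e e0.
have T0 : 0 < `|T| + 1 by rewrite ltr_wpDl.
have /near_pinfty_shift := h0 _ (divr_gt0 e0 T0); apply: filter_app.
near=> t => ht s /andP[s0 sT].
have t0 : 0 < t by near: t; exact: nbhs_pinfty_gt.
have [c tc [_ ->]] := is_derive_increment dh t0 s0.
rewrite normrM -(@divfK _ (`|T| + 1) _ e) ?gt_eqF // ler_pM //.
  by have := ht (c - t); rewrite subr_ge0 subrKC; exact.
by rewrite ger0_norm // (le_trans sT) // (le_trans (ler_norm _)) // lerDl.
Unshelve. all: by end_near. Qed.

(* Over a time [T] a function bounded by [M] has mean derivative at most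
   [2 M / T], and the derivative hardly moves during that time. *)
Lemma cvg0_derive_slowly_varying f f' M :
    (forall t, 0 < t -> is_derive t 1 f (f' t)) ->
    (\forall t \near +oo, `|f t| <= M) -> slowly_varying f' ->
  f' t @[t --> +oo] --> (0 : R).
Proof.
move=> df /near_pinfty_shift fM sf; apply/cvg0_pinftyP => e e0.
pose T := 4 * (`|M| + 1) / e.
have T0 : 0 < T by rewrite divr_gt0 // mulr_gt0 // ltr_wpDl.
have := sf T _ (divr_gt0 e0 (ltr0n R 2)); move: fM; apply: filter_app2.
near=> t => fMt sft.
have t0 : 0 < t by near: t; exact: nbhs_pinfty_gt.
have [c tc [cT fE]] := is_derive_increment df t0 (ltW T0).
have f'c : `|f' c| <= e / 2.
  rewrite -(ler_pM2r T0) -{1}(gtr0_norm T0) -normrM -fE.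
  rewrite (le_trans (ler_normB _ _)) //.
  have := fMt T (ltW T0); have := fMt 0 (lexx 0); rewrite addr0 => h1 h2.
  rewrite (le_trans (lerD h2 h1)) // (_ : e / 2 * T = 2 * (`|M| + 1)); last first.
    by rewrite /T; field; rewrite gt_eqF.
  by have := ler_norm M; lra.
have := sft (c - t); rewrite subr_ge0 tc lerBlDl cT subrKC => /(_ isT) h.
rewrite -[f' t](subKr (f' c)) (le_trans (ler_normB _ _)) // (splitr e) lerD //.
Unshelve. all: by end_near. Qed.

(** A value of [W] above [e] stays above [e / 2] for a time [r] independent of its date, so [f]
    falls by at least [e / 2 * r]. A nonincreasing [f] bounded below cannot do this at late
    times. *)
Lemma barbalat f W m :
    (forall t, 0 < t -> is_derive t 1 f (- W t)) -> (forall t, 0 < t -> 0 <= W t) ->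
    (forall t, 0 < t -> m <= f t) ->
    (forall e, 0 < e -> exists2 r, 0 < r & forall t s, 1 <= t -> 0 <= s <= r ->
       `|W (t + s) - W t| <= e) ->
  W t @[t --> +oo] --> (0 : R).
Proof.
move=> df W0 fm uW; apply/cvg0_pinftyP => e e0.
have f_dec t s : 0 < t -> 0 <= s -> f (t + s) <= f t.
  move=> t0 s0; have [c tc [_ fE]] := is_derive_increment df t0 s0.
  by rewrite -subr_le0 fE mulNr oppr_le0 mulr_ge0 // W0 // (lt_le_trans t0).
have [r r0 ur] := uW _ (divr_gt0 e0 (ltr0n R 2)).
pose A := [set f t | t in [set t | 1 <= t]].
have A1 : A (f 1) by exists 1 => /=.
have hiA : has_inf A.
  split; first by exists (f 1).
  by exists m => _ [t /= t1 <-]; apply: fm; rewrite (lt_le_trans ltr01).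
have er0 : 0 < e / 2 * r by rewrite mulr_gt0 // divr_gt0.
(* After [t0] the function [f] can lose less than [e / 2 * r]. *)
have [_ [t0 /= t01 <-] ft0] := inf_adherent er0 hiA.
near=> t.
have tt : t0 <= t by near: t; apply: nbhs_pinfty_ge; rewrite num_real.
have t1 : 1 <= t by exact: le_trans tt.
have tp : 0 < t by rewrite (lt_le_trans ltr01).
rewrite ger0_norm ?W0 // leNgt; apply/negP => eW.
have [c tc [cr fE]] := is_derive_increment df tp (ltW r0).
have Wc : e / 2 <= W c.
  have := ur t (c - t) t1; rewrite subr_ge0 tc lerBlDl cr subrKC => /(_ isT).
  by rewrite ler_norml => /andP[]; lra.
have : inf A <= f (t + r).
  apply: (ge_inf hiA.2); exists (t + r) => //=.
  by rewrite (le_trans t1) // lerDl ltW.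
have : f t <= f t0.
  rewrite -(subrKC t0 t); apply: f_dec; first by rewrite (lt_le_trans ltr01).
  by rewrite subr_ge0.
have : e / 2 * r <= W c * r by rewrite ler_wpM2r // ltW.
move: fE; lra.
Unshelve. all: by end_near. Qed.

End SlowVariation.

(** * Compactness, continuity and distance to a closed set *)

Section Topology.
Context {R : realType}.

Lemma mx_norm_coord n m (M : 'M[R]_(n, m)) i j : `|M i j| <= `|M|.
Proof.
rewrite [leRHS]/Num.Def.normr /= mx_normrE.
exact: (le_bigmax _ (fun ij => `|M ij.1 ij.2|) (i, j)).
Qed.

Lemma mx_norm_le n m (M : 'M[R]_(n, m)) (e : R) :
  0 <= e -> (forall i j, `|M i j| <= e) -> `|M| <= e.
Proof.
by move=> e0 Me; rewrite [leLHS]/Num.Def.normr /= mx_normrE bigmax_le.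
Qed.

Lemma continuous_trmx n m : continuous (@trmx R n m).
Proof.
move=> M s /nbhs_ballP[e e0 es]; apply/nbhs_ballP; exists e => // N [_ MN].
by apply: es; split => // i j; rewrite !mxE; exact: MN.
Qed.

Lemma cV_box_compact n (M : R) :
  compact [set v : 'cV[R]_n | forall i, `|v i 0| <= M].
Proof.
have rVc : compact [set v : 'rV[R]_n | forall i, v ord0 i \in `[- M, M]].
  by apply: (@rV_compact _ _ (fun=> `[- M, M]%classic)) => _; exact: segment_compact.
rewrite (_ : mkset _ = trmx @` [set v : 'rV[R]_n | forall i, v ord0 i \in `[- M, M]]).
  apply: continuous_compact rVc; apply: continuous_subspaceT.
  exact: continuous_trmx.
apply/seteqP; split=> [v vM|_ [v vM <-] i].
  exists v^T; last by rewrite trmxK.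
  by move=> i; rewrite /= mxE in_itv /= -ler_norml.
by have := vM i; rewrite /= mxE in_itv /= -ler_norml.
Qed.

Section Pointwise.
Context {T : topologicalType}.
Implicit Types f g : T -> R.

Lemma continuous_add f g :
  continuous f -> continuous g -> continuous (fun x => f x + g x).
Proof. by move=> cf cg x; apply: cvgD; [exact: cf|exact: cg]. Qed.

Lemma continuous_opp f : continuous f -> continuous (fun x => - f x).
Proof. by move=> cf x; apply: cvgN; exact: cf. Qed.

Lemma continuous_sub f g :
  continuous f -> continuous g -> continuous (fun x => f x - g x).
Proof. by move=> cf cg x; apply: cvgB; [exact: cf|exact: cg]. Qed.

Lemma continuous_mul f g :
  continuous f -> continuous g -> continuous (fun x => f x * g x).
Proof. by move=> cf cg x; apply: cvgM; [exact: cf|exact: cg]. Qed.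

Lemma continuous_sum (I : finType) (f : I -> T -> R) :
  (forall i, continuous (f i)) -> continuous (fun x => \sum_i f i x).
Proof.
move=> cf.
suff H (r : seq I) : continuous (fun x => \sum_(i <- r) f i x) by exact: H.
elim: r => [|i r IH] x.
  by under eq_fun do rewrite big_nil; exact: cvg_cst.
by under eq_fun do rewrite big_cons; apply: cvgD; [exact: cf|exact: IH].
Qed.

End Pointwise.

Lemma compact_gt0_lower_bound (T : topologicalType) (A : set T) (f : T -> R) :
    compact A -> continuous f -> (forall x, A x -> 0 < f x) ->
  exists2 e, 0 < e & forall x, A x -> e <= f x.
Proof.
move=> cA cf f0.
have [->|/set0P A0] := eqVneq A set0; first by exists 1.
have [c /set_mem Ac fc] := compact_EVT_min A0 cA (continuous_subspaceT cf).
by exists (f c); [exact: f0|move=> x /mem_set; exact: fc].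
Qed.

Lemma compact_norm_bounded (T : topologicalType) (A : set T) (f : T -> R) :
  compact A -> continuous f -> exists2 M, 0 < M & forall x, A x -> `|f x| <= M.
Proof.
move=> cA cf.
have /compact_bounded/ex_strict_bound_gt0[M M0 fM] : compact (f @` A).
  exact: continuous_compact (continuous_subspaceT cf) cA.
by exists M => // x Ax; apply/ltW/fM; exists x.
Qed.

(** The pairs in [K] whose values differ by at least [e] form a compact set off the diagonal, on
    which the distance of the two points has a positive lower bound. *)
Lemma compact_uniformly_continuous (V : normedModType R) (K : set V) (f : V -> R) :
    compact K -> continuous f -> forall e, 0 < e ->
  exists2 d, 0 < d & forall p q, K p -> K q -> `|p - q| <= d -> `|f p - f q| <= e.
Proof.
move=> cK cf e e0.
pose D := fun pq : V * V => `|f pq.1 - f pq.2|.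
have cD : continuous D.
  move=> pq; apply: cvg_norm; apply: cvgB.
    by apply: continuous_comp; [exact: cvg_fst|exact: cf].
  by apply: continuous_comp; [exact: cvg_snd|exact: cf].
have cA : compact ((K `*` K) `&` [set pq | e <= D pq]).
  apply: compact_closedI; first exact: compact_setX.
  exact: (preimage_closed (fun _ _ => cD _) (@closed_ge _ e)).
have cn : continuous (fun pq : V * V => `|pq.1 - pq.2|).
  by move=> pq; apply: cvg_norm; apply: cvgB; [exact: cvg_fst|exact: cvg_snd].
have [[p q] [_ /= eD]|d d0 dA] := compact_gt0_lower_bound cA cn.
  rewrite normr_gt0 subr_eq0; apply: contraTneq eD => -> /=.
  by rewrite /D /= subrr normr0 -ltNge.
exists (d / 2); first by rewrite divr_gt0.
move=> p q Kp Kq pqd; rewrite leNgt; apply/negP => eD.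
have := dA (p, q) (conj (conj Kp Kq) (ltW eD)).
by rewrite /= leNgt (le_lt_trans pqd) // ltr_pdivrMr // ltr_pMr // ltr1n.
Qed.

Lemma continuous_comp_fst (S T : topologicalType) (f : S -> R) :
  continuous f -> continuous (fun z : S * T => f z.1).
Proof.
by move=> cf z; apply: continuous_comp; [exact: cvg_fst|exact: cf].
Qed.

Lemma continuous_comp_snd (S T : topologicalType) (f : T -> R) :
  continuous f -> continuous (fun z : S * T => f z.2).
Proof.
by move=> cf z; apply: continuous_comp; [exact: cvg_snd|exact: cf].
Qed.

Lemma continuous_post (T : topologicalType) (f : T -> R) (g : R -> R) :
  continuous g -> continuous f -> continuous (g \o f).
Proof. by move=> cg cf x; apply: continuous_comp; [exact: cf|exact: cg]. Qed.

Lemma continuous_translate (V : normedModType R) (f : V -> R) (x : V) :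
  continuous f -> continuous (fun v => f (x + v)).
Proof.
move=> cf v; apply: continuous_comp; last exact: cf.
by apply: cvgD; [exact: cvg_cst|exact: cvg_id].
Qed.

Lemma edist_inf_eq0 (V : normedModType R) (A : set V) (z : V) :
  closed A -> edist_inf A z = 0%E -> A z.
Proof.
move=> clA dz; apply: clA => B /nbhs_ballP[e /= e0 eB].
have : (ereal_inf [set edist (z, a) | a in A] < e%:E)%E.
  by rewrite -/(edist_inf A z) dz lte_fin.
move=> /ereal_inf_lt [_ [a Aa <-]] zae; exists a; split=> //; apply: eB.
by move/edist_lt_ball: zae.
Qed.

End Topology.

(** * Strict convexity: growth of the excess and local surjectivity of the gradient *)

Section Convexity.
Context {R : realType} {n : nat}.
Implicit Types (f H : 'cV[R]_n -> R) (v x : 'cV[R]_n).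

Lemma cV_sum_delta v : v = \sum_i v i 0 *: delta_mx i 0.
Proof.
by rewrite {1}(matrix_sum_delta v); apply: eq_bigr => i _; rewrite big_ord1.
Qed.

Lemma is_derive_curve f (x : R -> 'cV[R]_n) t v :
    differentiable f (x t) -> is_derive t 1 x v ->
  is_derive t 1 (f \o x) (\sum_i v i 0 * 'D_(delta_mx i 0) f (x t)).
Proof.
move=> df [dx dxE].
have dx' : differentiable x t by apply/derivable1_diffP.
have dfx : differentiable (f \o x) t by exact: differentiable_comp.
apply: DeriveDef; first exact: diff_derivable.
have dxv : 'd x t 1 = v by rewrite -deriveE.
rewrite deriveE // diff_comp //= dxv {1}(cV_sum_delta v) linear_sum.
by apply: eq_bigr => i _; rewrite linearZ /= deriveE.
Qed.

Lemma is_derive_coord (x : R -> 'cV[R]_n) (t : R) v i :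
  is_derive t 1 x v -> is_derive t 1 (fun t => x t i 0) (v i 0).
Proof.
move=> [dx dxE]; apply: DeriveDef; first exact: (derivable_mxP _ _ _).1.
by rewrite -dxE derive_mx // mxE.
Qed.

Lemma is_derive_line x v (s : R) : is_derive s 1 (fun s : R => x + s *: v) v.
Proof.
have [d dE] : is_diff s (cst x + *:%R^~ v) (0 + *:%R^~ v) by apply: is_diffD.
apply: DeriveDef; first exact: diff_derivable.
by rewrite deriveE // dE !fctE add0r scale1r.
Qed.

Context (H : 'cV[R]_n -> R).
Hypothesis H_diff : forall x, differentiable H x.
Hypothesis g_diff : forall x, differentiable (gradient H) x.
Hypothesis H_hess : forall x, positive_definite (hessian H x).

Lemma differentiable_gradient_coord i x :
  differentiable (fun x => gradient H x i 0) x.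
Proof.
apply: (@differentiable_comp _ _ _ _ (gradient H) (fun M => M i 0)) => //.
exact: differentiable_coord.
Qed.

Lemma continuous_energy : continuous H.
Proof. by move=> x; exact: differentiable_continuous. Qed.

Lemma continuous_gradient_coord i : continuous (fun x => gradient H x i 0).
Proof.
by move=> x; apply: differentiable_continuous; exact: differentiable_gradient_coord.
Qed.

(** The Bregman divergence of [H] with base point [x0]. *)
Definition excess x0 x :=
  H x - H x0 - \sum_i (x i 0 - x0 i 0) * gradient H x0 i 0.

(** The derivative of the excess along the ray from [x0] in direction [v]; its own derivative is the
    Hessian form, so it increases strictly. *)
Definition slope x0 v (s : R) :=
  \sum_i v i 0 * (gradient H (x0 + s *: v) i 0 - gradient H x0 i 0).

Lemma is_derive_excess x0 v (s : R) :
  is_derive s 1 (fun s => excess x0 (x0 + s *: v)) (slope x0 v s).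
Proof.
have dH := is_derive_curve (H_diff _) (is_derive_line x0 v s).
have -> : (fun s => excess x0 (x0 + s *: v)) =
    (H \o (fun s => x0 + s *: v)) - cst (H x0)
    - (fun s => s * \sum_i v i 0 * gradient H x0 i 0).
  apply/funext => u; rewrite /excess !fctE /=; congr (_ - _).
  by rewrite mulr_sumr; apply: eq_bigr => i _; rewrite !mxE addrAC subrr add0r mulrA.
apply: is_derive_eq; rewrite subr0 scaler0 add0r [_%:A]mulr1 -sumrB.
by apply: eq_bigr => i _; rewrite -mulrBr [gradient H (_ + _) i 0]mxE.
Qed.

Lemma is_derive_slope x0 v (s : R) :
  is_derive s 1 (slope x0 v) ((v^T *m hessian H (x0 + s *: v) *m v) 0 0).
Proof.
have dg i := is_derive_curve (differentiable_gradient_coord i _) (is_derive_line x0 v s).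
have -> : slope x0 v = \sum_(i < n) (v i 0 \*: (((fun x => gradient H x i 0) \o
    (fun s : R => x0 + s *: v)) - cst (gradient H x0 i 0))).
  by apply/funext => u; rewrite fct_sumE.
apply: is_derive_eq; rewrite mxE.
under eq_bigr do rewrite subr0.
under [RHS]eq_bigr do rewrite mxE mulr_suml.
rewrite exchange_big; apply: eq_bigr => i _; rewrite scaler_sumr.
by apply: eq_bigr => j _; rewrite !mxE -[RHS]mulrA; congr (_ * _); rewrite mulrC.
Qed.

Lemma slope_lt x0 v (s t : R) : v != 0 -> s < t -> slope x0 v s < slope x0 v t.
Proof.
move=> v0 st.
have [c _ e] := is_derive_MVT (ltW st) (fun u _ => is_derive_slope x0 v u).
by rewrite -subr_gt0 e mulr_gt0 ?subr_gt0 //; exact: H_hess.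
Qed.

Lemma slope0 x0 v : slope x0 v 0 = 0.
Proof. by rewrite /slope big1 // => i _; rewrite scale0r addr0 subrr mulr0. Qed.

Lemma excess0 x0 : excess x0 x0 = 0.
Proof. by rewrite /excess subrr sub0r big1 ?oppr0 // => i _; rewrite subrr mul0r. Qed.

Lemma excess_gt0 x0 v : v != 0 -> 0 < excess x0 (x0 + v).
Proof.
(* The mean value theorem may return the end 0, where the slope vanishes. Splitting [[0, 1]] in the
   middle keeps the second point positive. *)
move=> v0; have h2 : (0 : R) <= 2^-1 by rewrite invr_ge0.
have h1 : (2^-1 : R) <= 1 by rewrite invf_le1 ?ler1n.
have [c /andP[c0 _]] := is_derive_MVT h2 (fun u _ => is_derive_excess x0 v u).
have [c' /andP[c'0 _]] := is_derive_MVT h1 (fun u _ => is_derive_excess x0 v u).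
rewrite scale0r addr0 excess0 !subr0 scale1r => e1 e2.
have : 0 < slope x0 v c'.
  by rewrite -(slope0 x0 v) slope_lt // (lt_le_trans _ c'0) // invr_gt0.
have : 0 <= slope x0 v c.
  rewrite -(slope0 x0 v); move: c0; rewrite le_eqVlt => /predU1P[<-//|c0].
  exact: ltW (slope_lt _ v0 c0).
by nra.
Qed.

(** The slope is monotone, so its mean over [[1, r]] is at least its mean over [[0, 1]], which is
    [excess x0 (x0 + v)]. *)
Lemma excess_superlinear x0 v (r : R) : v != 0 -> 1 <= r ->
  r * excess x0 (x0 + v) <= excess x0 (x0 + r *: v).
Proof.
move=> v0 r1.
have [c /andP[_ c1]] := is_derive_MVT ler01 (fun u _ => is_derive_excess x0 v u).
have [c' /andP[c'1 _]] := is_derive_MVT r1 (fun u _ => is_derive_excess x0 v u).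
rewrite scale0r addr0 excess0 !subr0 scale1r => e1 e2.
have : slope x0 v c <= slope x0 v c'.
  have := le_trans c1 c'1; rewrite le_eqVlt => /predU1P[<-//|cc'].
  exact: ltW (slope_lt _ v0 cc').
by nra.
Qed.

Lemma continuous_excess x0 : continuous (excess x0).
Proof.
apply: continuous_sub.
  by apply: continuous_sub; [exact: continuous_energy|exact: cst_continuous].
apply: continuous_sum => i; apply: continuous_mul; last exact: cst_continuous.
by apply: continuous_sub; [exact: coord_continuous|exact: cst_continuous].
Qed.

(** Here [mu] bounds the excess from below on the unit sphere about [x0], and superlinear growth
    carries the bound outwards. Inside the unit ball the left-hand side is nonpositive, so
    nonnegativity of the excess is enough. *)
Lemma excess_coercive x0 :
  exists2 mu, 0 < mu & forall x, mu * (`|x - x0| - 1) <= excess x0 x.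
Proof.
have cS : compact ([set v : 'cV[R]_n | forall i, `|v i 0| <= 1] `&` [set v | `|v| = 1]).
  apply: compact_closedI; first exact: cV_box_compact.
  apply: (@preimage_closed _ _ (fun v : 'cV[R]_n => `|v|) [set 1]); last exact: closed_eq.
  by move=> v _; exact: norm_continuous.
have ce := @continuous_translate _ _ _ x0 (@continuous_excess x0).
have [v [_ /= v1]|mu mu0 emu] := compact_gt0_lower_bound cS ce.
  by apply: excess_gt0; rewrite -normr_gt0 v1.
exists mu => // x.
have [xx0|xx0] := lerP `|x - x0| 1.
  apply: (@le_trans _ _ 0); first by rewrite pmulr_rle0 // subr_le0.
  have [->|xx] := eqVneq x x0; first by rewrite excess0.
  by rewrite -[x](subrKC x0) ltW // excess_gt0 // subr_eq0.
set r := `|x - x0| in xx0 *; have r0 : 0 < r by rewrite (lt_trans ltr01).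
pose v := r^-1 *: (x - x0).
have v1 : `|v| = 1 by rewrite normrZ normfV (gtr0_norm r0) mulVf ?gt_eqF.
have -> : x = x0 + r *: v by rewrite scalerA divff ?gt_eqF // scale1r subrKC.
apply: le_trans (excess_superlinear _ _ (ltW xx0)); last by rewrite -normr_gt0 v1.
have : mu <= excess x0 (x0 + v).
  by apply: emu; split=> //= i; rewrite -v1; exact: mx_norm_coord.
by nra.
Qed.

(** Subtracting a small linear form from the excess leaves it coercive, so a minimum exists; there
    the gradient of [H] is shifted by exactly that form. *)
Lemma gradient_locally_onto x0 : exists2 e, 0 < e &
  forall b : 'cV[R]_n, (forall i, `|b i 0| <= e) ->
    exists x, gradient H x = gradient H x0 + b.
Proof.
have [mu mu0 emu] := excess_coercive x0.
have n0 : (0 : R) < n.+1%:R by rewrite ltr0n.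
(* Over [n] coordinates this keeps the linear term below half of [mu] times the distance to [x0];
   [n.+1] keeps the denominator nonzero when [n = 0]. *)
exists (mu / (2 * n.+1%:R)) => [|b be]; first by rewrite divr_gt0 // mulr_gt0.
pose psi x := excess x0 x - \sum_i (x i 0 - x0 i 0) * b i 0.
have cpsi : continuous psi.
  apply: continuous_sub; first exact: continuous_excess.
  apply: continuous_sum => i; apply: continuous_mul; last exact: cst_continuous.
  by apply: continuous_sub; [exact: coord_continuous|exact: cst_continuous].
have psi0 : psi x0 = 0.
  by rewrite /psi excess0 sub0r big1 ?oppr0 // => i _; rewrite subrr mul0r.
have psi_ge x : mu / 2 * `|x - x0| - mu <= psi x.
  have : \sum_i (x i 0 - x0 i 0) * b i 0 <= mu / 2 * `|x - x0|.
    apply: (@le_trans _ _ (\sum_(i < n) `|x - x0| * (mu / (2 * n.+1%:R)))).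
      apply: ler_sum => i _; rewrite (le_trans (ler_norm _)) // normrM ler_pM //.
      by have := mx_norm_coord (x - x0) i 0; rewrite !mxE.
    rewrite sumr_const card_ord -[_ *+ n]mulr_natr -mulrA [leRHS]mulrC ler_wpM2l //.
    rewrite mulrAC ler_pdivrMr ?mulr_gt0 // mulrA divfK // ler_wpM2l ?(ltW mu0) //.
    by rewrite ler_nat.
  have := emu x; rewrite /psi; nra.
(* [K] contains the ball of radius 3 about [x0]. Outside that ball [psi] is at least [mu / 2], hence
   above [psi x0 = 0], so a minimum over [K] is global. *)
pose K := [set v : 'cV[R]_n | forall i, `|v i 0| <= `|x0| + 3].
have inK x : `|x - x0| <= 3 -> K x.
  move=> x3 i; rewrite (le_trans (mx_norm_coord x i 0)) //.
  by rewrite -[x](subrKC x0) (le_trans (ler_normD _ _)) // lerD2l.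
have Kx0 : K x0 by apply: inK; rewrite subrr normr0.
have K0 : K !=set0 by exists x0.
have [c /set_mem Kc cmin] :=
  compact_EVT_min K0 (@cV_box_compact _ _ _) (continuous_subspaceT cpsi).
have {}cmin x : psi c <= psi x.
  have [/inK/mem_set/cmin//|x3] := lerP `|x - x0| 3.
  rewrite (le_trans (cmin x0 (mem_set Kx0))) // psi0 (le_trans _ (psi_ge x)) //.
  by nra.
exists c; apply/matrixP => i j; rewrite ord1 [RHS]mxE {j}.
pose v : 'cV[R]_n := delta_mx i 0; pose w := gradient H x0 i 0 + b i 0.
have vE k : v k 0 = (k == i)%:R by rewrite mxE eqxx andbT.
(* Up to an additive constant, [h] is [psi] on the line through [c] along axis [i]. Its derivative
   at 0 is computed once by the chain rule and once from minimality. *)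
pose h := (H \o (fun s : R => c + s *: v)) - (fun s => s * w).
have psiE s : psi (c + s *: v) = h s + (psi c - H c).
  rewrite /psi /h /excess !fctE /= /w.
  have sumE (u : 'cV[R]_n) : \sum_k ((c + s *: v) k 0 - x0 k 0) * u k 0 =
      \sum_k (c k 0 - x0 k 0) * u k 0 + s * u i 0.
    under eq_bigr do rewrite mxE [(s *: v) _ _]mxE vE addrAC mulrDl -mulrA.
    rewrite big_split /= -mulr_sumr; congr (_ + _ * _).
    by rewrite (bigD1 i) //= eqxx mul1r big1 ?addr0 // => k /negPf->; rewrite mul0r.
  by rewrite !sumE; ring.
have dh : is_derive (0 : R) 1 h (gradient H c i 0 - w).
  have dH := is_derive_curve (H_diff _) (is_derive_line c v 0).
  apply: is_derive_eq; rewrite scale0r addr0 scaler0 add0r [_%:A]mulr1.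
  rewrite (bigD1 i) //= vE eqxx mul1r [gradient H c _ _]mxE big1 ?addr0 // => k /negPf ki.
  by rewrite vE ki mul0r.
have dh0 : is_derive (0 : R) 1 h 0.
  apply: (@derive1_at_min _ h (-1) 1 0); rewrite ?in_itv /= ?oppr_lt0 ?ltr01 //.
  - move=> t _.
    have dH := is_derive_curve (H_diff _) (is_derive_line c v t).
    exact: ex_derive.
  - move=> t _; have := cmin (c + t *: v); rewrite psiE.
    have := psiE 0; rewrite scale0r addr0; lra.
have /eqP : gradient H c i 0 - w = 0.
  exact: etrans (esym (@derive_val _ _ _ _ _ _ _ dh)) (@derive_val _ _ _ _ _ _ _ dh0).
by rewrite subr_eq0 => /eqP.
Qed.

End Convexity.

(** * Derivatives of the two primitives, and slow variation through the cubic *)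

Section ClampDerivatives.
Context {R : realType}.
Implicit Types F : R -> R.

Lemma is_derive_tangent F (u l C : R) :
  (forall v, `|F v - F u - l * (v - u)| <= C * (v - u) ^+ 2) -> is_derive u 1 F l.
Proof.
move=> FC.
have lim : h^-1 *: (F (h *: 1 + u) - F u) @[h --> 0^'] --> l.
  apply/cvgrPdist_le => e e0; near=> h.
  have h0 : h != 0 by near: h; exact: nbhs_dnbhs_neq.
  have := FC (h + u); rewrite addrK => FCh.
  rewrite [h *: 1]mulr1 distrC.
  rewrite (_ : _ - l = h^-1 * (F (h + u) - F u - l * h)); last first.
    by rewrite mulrBr [_ * (l * h)]mulrCA mulVf // mulr1.
  rewrite normrM normfV ler_pdivrMl ?normr_gt0 //.
  rewrite (le_trans FCh) // -[h ^+ 2]real_normK ?num_real // expr2 mulrCA ler_wpM2l //.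
  have C0 : 0 < `|C| + 1 by rewrite ltr_wpDl.
  have he : `|h| <= e / (`|C| + 1).
    by near: h; apply: dnbhs0_le; rewrite divr_gt0.
  rewrite (le_trans (ler_wpM2r (normr_ge0 h) (ler_norm C))) //.
  rewrite -(@divfK _ (`|C| + 1) _ e) ?gt_eqF // mulrC ler_pM // lerDl //.
apply: DeriveDef; first by apply/cvg_ex; exists l.
exact: cvg_lim lim.
Unshelve. all: by end_near. Qed.

Lemma is_derive_clamp_primitive (a b u : R) : a < b ->
  is_derive u 1 (clamp_primitive a b) (clamp a b u).
Proof.
move=> ab; apply: (@is_derive_tangent _ _ _ 1) => v.
have /andP[h0 h1] := clamp_primitive_tangent ab u v.
by rewrite mul1r ger0_norm.
Qed.

Lemma is_derive_clamp_cubic (a b u : R) : a < b ->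
  is_derive u 1 (clamp_cubic a b \o clamp a b) ((clamp a b u - a) * (b - clamp a b u)).
Proof. by move=> ab; apply: is_derive_tangent => v; exact: clamp_cubic_tangent. Qed.

Lemma continuous_clamp (a b : R) : a < b -> continuous (clamp a b).
Proof.
move=> ab u; apply/cvgrPdist_le => e e0; near=> v.
rewrite (le_trans (clamp_lipschitz ab u v)) //.
Unshelve. all: by end_near. Qed.

(** An increment of [h] beyond [e] would change the cubic by more than [e ^+ 3 / 6], so slow
    variation can be pulled back. *)
Lemma slowly_varying_clamp_cubic (a b : R) (h : R -> R) :
    (forall t, a <= h t <= b) ->
  slowly_varying (clamp_cubic a b \o h) -> slowly_varying h.
Proof.
move=> hab sh; apply: (@slowly_varying_uniform _ 'I_1 (fun=> clamp_cubic a b \o h)) => //.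
move=> e e0; exists (e ^+ 3 / 6); first by rewrite divr_gt0 // exprn_gt0.
move=> t s _ _ /(_ ord0) /=; apply: contraTT; rewrite -!ltNge.
have cube (c c' : R) : a <= c -> c' <= b -> e < c' - c ->
    e ^+ 3 / 6 < clamp_cubic a b c' - clamp_cubic a b c.
  move=> ac cb ec; have := clamp_cubic_incr ac _ cb.
  rewrite -subr_ge0 => /(_ (ltW (lt_trans e0 ec))); apply: lt_le_trans.
  by rewrite ltr_pM2r // ltr_pXn2r // nnegrE ltW // (lt_trans e0 ec).
have /andP[? ?] := hab t; have /andP[? ?] := hab (t + s).
rewrite !ltr_normr => /orP[] eh; apply/orP; [left|right; rewrite opprB];
  apply: cube => //.
by rewrite -opprB.
Qed.

End ClampDerivatives.

(** * Incidence matrix, connectivity and admissible steady flows *)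

Section Incidence.
Context {R : realType} {n m : nat} (G : digraph n m).

Lemma incidence_sum (w : 'I_n -> R) j :
  \sum_i incidence R G i j * w i = w (Defs.head G j) - w (Defs.tail G j).
Proof.
have th := tail_neq_head G j.
rewrite (bigD1 (Defs.head G j)) //= mxE eqxx mul1r (bigD1 (Defs.tail G j)) //= mxE eqxx.
rewrite (negPf th) mulN1r big1 ?addr0 // => i /andP[/negPf ih /negPf it_].
by rewrite mxE ih it_ mul0r.
Qed.

Lemma weakly_connected_const (T : Type) (w : 'I_n -> T) : weakly_connected G ->
  (forall j, w (Defs.head G j) = w (Defs.tail G j)) -> forall v v', w v = w v'.
Proof.
move=> conn wG v v'; have /connectP[p pth ->] := conn v v'.
elim: p v pth => //= u p IH v /andP[/existsP[j vu] pth]; rewrite -(IH u pth).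
by case/orP: vu => /andP[/eqP<- /eqP<-].
Qed.

End Incidence.

(** Each permission interval is symmetric about 0 and lies within the flow bounds, so it admits
    [- c] along with [c]. *)
Lemma permission_opp_range (R : realType) m (um up c : 'cV[R]_m) :
  (forall i, um i 0 < 0 < up i 0) -> permission_set um up c ->
  forall i, um i 0 < - c i 0 < up i 0.
Proof.
move=> u0 cP i; have /andP[un u1] := u0 i; have := cP i.
rewrite /permission_interval ltr0_norm // gtr0_norm //.
by case: (leP (- um i 0)) => h; rewrite in_itv /= => /andP[c0 c1]; apply/andP; split; lra.
Qed.

(** * Lyapunov function and target set of the closed loop *)

Section ClosedLoopAnalysis.
Context {R : realType} {n m k : nat}.
Variables (G : digraph n m) (um up : 'cV[R]_m) (H : 'cV[R]_n -> R).
Variables (E : 'M[R]_(n, k)) (d : 'cV[R]_k) (c : 'cV[R]_m) (xs : 'cV[R]_n) (a : R).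

Hypothesis H_diff : forall x, differentiable H x.
Hypothesis g_diff : forall x, differentiable (gradient H) x.
Hypothesis H_hess : forall x, positive_definite (hessian H x).
Hypothesis c_range : forall j, um j 0 < - c j 0 < up j 0.
Hypothesis inflow : E *m d = incidence R G *m c.
Hypothesis xs_crit : gradient H xs = const_mx a.

Local Notation B := (incidence R G).
Local Notation state := ('cV[R]_n * 'cV[R]_m)%type.
Implicit Types (z : state) (i : 'I_n) (j : 'I_m) (t s e : R).

Lemma um_lt_up j : um j 0 < up j 0.
Proof. by have /andP[h1 h2] := c_range j; exact: lt_trans h2. Qed.

(* In the paper's notation, with [z = (x, x_c)]: [drop z] is B^T grad H(x),
   [flow z] is sat(-B^T grad H(x) - x_c), [integral_flow z] is sat(-x_c), and [c]
   is the steady flow xcbar. *)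
Definition drop z j : R :=
  gradient H z.1 (Defs.head G j) 0 - gradient H z.1 (Defs.tail G j) 0.

Definition integral_flow z j : R := clamp (um j 0) (up j 0) (- z.2 j 0).

Definition flow z j : R := clamp (um j 0) (up j 0) (- z.2 j 0 - drop z j).

Definition velocity z i : R := \sum_j B i j * (flow z j + c j 0).

Definition residual z i : R := \sum_j B i j * (integral_flow z j + c j 0).

Definition dissipation z j : R := drop z j * (integral_flow z j - flow z j).

Definition integral_storage z j : R :=
  clamp_primitive (um j 0) (up j 0) (- z.2 j 0) - c j 0 * z.2 j 0.

Definition lyapunov z : R := excess H xs z.1 + \sum_j integral_storage z j.

Lemma incidence_gradient x j : (B^T *m gradient H x) j 0 = drop (x, 0) j.
Proof.
rewrite mxE /drop /= -(incidence_sum G (fun i => gradient H x i 0)).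
by apply: eq_bigr => i _; rewrite mxE.
Qed.

Lemma field_velocity (x : 'cV[R]_n) (y : 'cV[R]_m) :
  B *m sat (- (B^T *m gradient H x) - y) um up + E *m d = \col_i velocity (x, y) i.
Proof.
rewrite inflow -mulmxDr; apply/matrixP => i j; rewrite ord1 !mxE.
apply: eq_bigr => l _; congr (_ * _); rewrite !mxE; congr (_ + _).
by have := incidence_gradient x l; rewrite mxE => ->; rewrite /flow /clamp addrC.
Qed.

Lemma field_residual (x : 'cV[R]_n) (y : 'cV[R]_m) :
  B *m sat (- y) um up + E *m d = \col_i residual (x, y) i.
Proof.
rewrite inflow -mulmxDr; apply/matrixP => i j; rewrite ord1 !mxE.
by apply: eq_bigr => l _; congr (_ * _); rewrite !mxE.
Qed.

(** Summation by parts on the graph. The gradient at [xs] is constant, so it has no difference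
    across any edge and drops out. *)
Lemma power_balance z :
  \sum_i velocity z i * (gradient H z.1 i 0 - gradient H xs i 0) =
  \sum_j (flow z j + c j 0) * drop z j.
Proof.
under eq_bigr do rewrite mulr_suml; rewrite exchange_big; apply: eq_bigr => j _ /=.
pose w i := gradient H z.1 i 0 - gradient H xs i 0.
transitivity ((flow z j + c j 0) * \sum_i B i j * w i).
  by rewrite mulr_sumr; apply: eq_bigr => i _; rewrite mulrAC mulrC.
by rewrite incidence_sum /w xs_crit ![const_mx a _ _]mxE /drop; congr (_ * _); ring.
Qed.

Lemma dissipation_ge0 z j : 0 <= dissipation z j.
Proof.
have := clamp_dissipation (um_lt_up j) (- z.2 j 0) (drop z j).
exact: le_trans (sqr_ge0 _).
Qed.

Lemma flow_gap_sqr z j : (flow z j - integral_flow z j) ^+ 2 <= dissipation z j.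
Proof. by rewrite -sqrrN opprB; exact: clamp_dissipation (um_lt_up j) _ _. Qed.

(* [- c j 0 - kappa j] and [- c j 0 + kappa j] are admissible tangent slopes of
   [clamp_primitive], which gives coercivity in both directions. *)
Definition kappa j := Num.min (- c j 0 - um j 0) (up j 0 + c j 0).
Definition offset j := ((- c j 0 - kappa j) ^+ 2 + (- c j 0 + kappa j) ^+ 2) / 2.

Lemma kappa_gt0 j : 0 < kappa j.
Proof. by have /andP[h1 h2] := c_range j; rewrite lt_min; apply/andP; split; lra. Qed.

Lemma offset_ge0 j : 0 <= offset j.
Proof. by rewrite divr_ge0 ?addr_ge0 ?sqr_ge0. Qed.

Lemma integral_storage_ge z j :
  kappa j * `|z.2 j 0| - offset j <= integral_storage z j.
Proof.
have /andP[c1 c2] := c_range j; have k0 := kappa_gt0 j; rewrite /integral_storage.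
have h1 : kappa j <= - c j 0 - um j 0 by rewrite ge_min lexx.
have h2 : kappa j <= up j 0 + c j 0 by rewrite ge_min lexx orbT.
rewrite /offset; move: (kappa j) k0 h1 h2 => K k0 h1 h2.
have p1 : um j 0 <= - c j 0 - K <= up j 0 by apply/andP; split; lra.
have p2 : um j 0 <= - c j 0 + K <= up j 0 by apply/andP; split; lra.
have {}p1 := clamp_primitive_ge (- z.2 j 0) p1.
have {}p2 := clamp_primitive_ge (- z.2 j 0) p2.
have s1 := sqr_ge0 (- c j 0 - K); have s2 := sqr_ge0 (- c j 0 + K).
by case: (ger0P (z.2 j 0)) => z0; lra.
Qed.

Lemma lyapunov_ge : exists m0, forall z, m0 <= lyapunov z.
Proof.
have [mu mu0 emu] := excess_coercive H_diff g_diff H_hess xs.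
exists (- mu - \sum_j offset j) => z; rewrite /lyapunov lerD //.
  rewrite (le_trans _ (emu z.1)) // mulrBr mulr1 lerBrDr addNr mulr_ge0 ?(ltW mu0) //.
rewrite -sumrN ler_sum // => j _; rewrite (le_trans _ (integral_storage_ge z j)) //.
by rewrite lerBrDr addNr mulr_ge0 // ltW // kappa_gt0.
Qed.

Lemma lyapunov_sublevel_bounded L : exists M, forall z, lyapunov z <= L ->
  (forall i, `|z.1 i 0| <= M) /\ (forall j, `|z.2 j 0| <= M).
Proof.
have [mu mu0 emu] := excess_coercive H_diff g_diff H_hess xs.
(* In [L1], one [O] absorbs the offset of the edge considered and the other the storage of the
   remaining edges; [mu] absorbs the least value allowed for the excess. *)
pose O := \sum_j offset j; pose L1 := `|L| + 2 * O + mu.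
have O0 : 0 <= O by apply: sumr_ge0 => j _; exact: offset_ge0.
have L10 : 0 <= L1 by rewrite !addr_ge0 ?mulr_ge0 // ltW.
pose M1 := `|xs| + L1 / mu + 1; pose M2 := \sum_j L1 / kappa j.
have M10 : 0 <= M1 by rewrite !addr_ge0 // divr_ge0 // ltW.
have t0 j : 0 <= L1 / kappa j by rewrite divr_ge0 // ltW // kappa_gt0.
have M20 : 0 <= M2 by rewrite sumr_ge0.
exists (M1 + M2) => z zL; have LL := ler_norm L.
have Sge (P : pred 'I_m) : - O <= \sum_(j | P j) integral_storage z j.
  apply: (@le_trans _ _ (- \sum_(j | P j) offset j)).
    rewrite lerN2 /O [leRHS](bigID P) /= lerDl sumr_ge0 // => j _; exact: offset_ge0.
  rewrite -sumrN ler_sum // => j _; rewrite (le_trans _ (integral_storage_ge z j)) //.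
  by rewrite lerBrDr addNr mulr_ge0 // ltW // kappa_gt0.
split=> [i|j].
  apply: (@le_trans _ _ M1); last by rewrite lerDl.
  rewrite (le_trans (mx_norm_coord z.1 i 0)) // -[z.1](subrKC xs).
  rewrite (le_trans (ler_normD _ _)) // /M1 -addrA lerD2l.
  have -> : L1 / mu + 1 = (L1 + mu) / mu by rewrite [RHS]mulrDl divff ?gt_eqF.
  rewrite ler_pdivlMr //; have := Sge predT; have := emu z.1.
  by move: zL; rewrite /lyapunov /L1; nra.
apply: (@le_trans _ _ M2); last by rewrite lerDr.
apply: (@le_trans _ _ (L1 / kappa j)); last first.
  by rewrite /M2 (bigD1 j) //= lerDl sumr_ge0.
rewrite ler_pdivlMr ?kappa_gt0 //.
have := integral_storage_ge z j; have := Sge (predC1 j).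
have : excess H xs z.1 >= - mu.
  rewrite (le_trans _ (emu z.1)) // mulrBr mulr1 lerBrDr addNr mulr_ge0 ?(ltW mu0) //.
have : offset j <= O.
  by rewrite /O (bigD1 j) //= lerDl sumr_ge0 // => i _; exact: offset_ge0.
move: zL; rewrite /lyapunov (bigD1 j) //= /L1.
by nra.
Qed.

Lemma continuous_gradient_state i : continuous (fun z => gradient H z.1 i 0).
Proof. exact: (continuous_comp_fst (@continuous_gradient_coord _ _ _ g_diff i)). Qed.

Lemma continuous_drop j : continuous (drop ^~ j).
Proof. by apply: continuous_sub; exact: continuous_gradient_state. Qed.

Lemma continuous_opp_integrator j : continuous (fun z => - z.2 j 0).
Proof.
apply: continuous_opp.
exact: (continuous_comp_snd (@coord_continuous _ _ _ j 0)).
Qed.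

Lemma continuous_integral_flow j : continuous (integral_flow ^~ j).
Proof.
exact: continuous_post (continuous_clamp (um_lt_up j)) (@continuous_opp_integrator j).
Qed.

Lemma continuous_flow j : continuous (flow ^~ j).
Proof.
apply: (continuous_post (continuous_clamp (um_lt_up j))).
by apply: continuous_sub; [exact: continuous_opp_integrator|exact: continuous_drop].
Qed.

Lemma continuous_velocity i : continuous (velocity ^~ i).
Proof.
apply: continuous_sum => j; apply: continuous_mul; first exact: cst_continuous.
by apply: continuous_add; [exact: continuous_flow|exact: cst_continuous].
Qed.

Lemma continuous_residual i : continuous (residual ^~ i).
Proof.
apply: continuous_sum => j; apply: continuous_mul; first exact: cst_continuous.
by apply: continuous_add; [exact: continuous_integral_flow|exact: cst_continuous].
Qed.

Lemma continuous_dissipation j : continuous (dissipation ^~ j).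
Proof.
apply: continuous_mul; first exact: continuous_drop.
by apply: continuous_sub; [exact: continuous_integral_flow|exact: continuous_flow].
Qed.

Lemma E_totP z : E_tot G um up H E d z <->
  (forall i, residual z i = 0) /\
  (forall i i', gradient H z.1 i 0 = gradient H z.1 i' 0).
Proof.
case: z => v w; rewrite /E_tot /= (field_residual v); split=> [[[b gb] r0]|[r0 gc]].
  split=> [i|i i']; last by rewrite gb !mxE.
  by have /matrixP/(_ i 0) := r0; rewrite !mxE.
split; last by apply/matrixP => i j; rewrite !mxE r0.
(* The common value is read at some vertex; on the empty graph any [alpha] will do. *)
have [i0 _|no] := pickP (fun _ : 'I_n => true).
  by exists (gradient H v i0 0); apply/matrixP => i j; rewrite ord1 (gc i i0) [RHS]mxE.
by exists 0; apply/matrixP => i; have := no i.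
Qed.

(** The set is the zero set of [f]. Gradients are compared over all pairs of vertices and not only
    along edges, because closedness serves the disconnected case. *)
Lemma closed_E_tot : closed (E_tot G um up H E d).
Proof.
pose f z := \sum_i `|residual z i|
  + \sum_i \sum_i' `|gradient H z.1 i 0 - gradient H z.1 i' 0|.
have cf : continuous f.
  apply: continuous_add; apply: continuous_sum => i.
    exact: (continuous_post (@norm_continuous _ R^o) (@continuous_residual i)).
  apply: continuous_sum => i'.
  apply: (continuous_post (@norm_continuous _ R^o)).
  by apply: continuous_sub; exact: continuous_gradient_state.
rewrite (_ : E_tot _ _ _ _ _ _ = f @^-1` [set 0]).
  by apply: preimage_closed; [move=> z _; exact: cf|exact: closed_eq].
apply/seteqP; split=> z /=.
  move=> /E_totP[r0 gc]; rewrite /f !big1 ?addr0 // => i _; last by rewrite r0 normr0.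
  by rewrite big1 // => i' _; rewrite (gc i i') subrr normr0.
have S0 : 0 <= \sum_i `|residual z i| by exact: sumr_ge0.
have T0 : 0 <= \sum_i \sum_i' `|gradient H z.1 i 0 - gradient H z.1 i' 0|.
  by apply: sumr_ge0 => i _; exact: sumr_ge0.
move=> /eqP; rewrite /f paddr_eq0 // => /andP[/eqP r0 /eqP g0].
apply/E_totP; split=> [i|i i'].
  by apply/eqP; rewrite -normr_eq0; apply/eqP; exact: (psumr_eq0P _ r0).
apply/eqP; rewrite -subr_eq0 -normr_eq0; apply/eqP; move: i' (erefl true).
apply: psumr_eq0P => //; apply: (psumr_eq0P _ g0) => // l _; exact: sumr_ge0.
Qed.

(** * Asymptotics of a fixed trajectory *)

Variables (x : R -> 'cV[R]_n) (y : R -> 'cV[R]_m).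
Hypothesis ode : forall t : R, 0 < t ->
  is_derive t 1 x (B *m sat (- (B^T *m gradient H (x t)) - y t) um up + E *m d) /\
  is_derive t 1 y (B^T *m gradient H (x t)).

Local Notation orbit t := ((x t, y t) : state).

Lemma is_derive_orbit1 i t : 0 < t ->
  is_derive t 1 (fun t => x t i 0) (velocity (orbit t) i).
Proof.
move=> /ode[dx _]; have := is_derive_coord i dx.
by rewrite field_velocity mxE.
Qed.

Lemma is_derive_orbit2 j t : 0 < t ->
  is_derive t 1 (fun t => y t j 0) (drop (orbit t) j).
Proof. by move=> /ode[_ /(is_derive_coord j)]; rewrite incidence_gradient. Qed.

Lemma is_derive_excess_orbit t : 0 < t ->
  is_derive t 1 (fun t => excess H xs (x t))
    (\sum_j (flow (orbit t) j + c j 0) * drop (orbit t) j).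
Proof.
move=> t0; have [dx _] := ode t0; rewrite field_velocity in dx.
have dH := is_derive_curve (H_diff _) dx.
have dxi i := is_derive_orbit1 i t0.
have -> : (fun t => excess H xs (x t)) = (H \o x) - cst (H xs)
    - \sum_(i < n) (gradient H xs i 0 \*: ((fun t => x t i 0) - cst (xs i 0))).
  apply/funext => u; rewrite /excess !fctE /=; congr (_ - _).
  by rewrite fct_sumE; apply: eq_bigr => i _; rewrite /= mulrC.
apply: is_derive_eq; rewrite -power_balance subr0 -sumrB.
apply: eq_bigr => i _; rewrite subr0 mxE mulrBr [in RHS]/gradient !mxE.
by congr (_ - _); rewrite mulrC.
Qed.

Lemma is_derive_integral_storage j t : 0 < t ->
  is_derive t 1 (fun t => integral_storage (orbit t) j)
    (- ((integral_flow (orbit t) j + c j 0) * drop (orbit t) j)).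
Proof.
move=> t0; have dy := is_derive_orbit2 j t0.
have dS := @is_derive1_comp _ _ (- (fun t => y t j 0)) t _ _
  (is_derive_clamp_primitive (- y t j 0) (um_lt_up j)) (is_deriveN dy).
have -> : (fun t => integral_storage (orbit t) j) =
    (clamp_primitive (um j 0) (up j 0) \o (- (fun t => y t j 0)))
    - c j 0 \*: (fun t => y t j 0).
  by apply/funext => u.
apply: is_derive_eq.
by rewrite /integral_flow /= mulrN mulrDl opprD.
Qed.

(** The power [c j 0 * drop] of the steady flow enters the excess and the storage with opposite
    signs and cancels. *)
Lemma is_derive_lyapunov t : 0 < t ->
  is_derive t 1 (fun t => lyapunov (orbit t)) (- \sum_j dissipation (orbit t) j).
Proof.
move=> t0; have dx := is_derive_excess_orbit t0.
have dy j := is_derive_integral_storage j t0.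
have -> : (fun t => lyapunov (orbit t)) = (fun t => excess H xs (x t))
    + \sum_(j < m) (fun t => integral_storage (orbit t) j).
  by apply/funext => u; rewrite /lyapunov !fctE fct_sumE.
apply: is_derive_eq; rewrite -big_split -sumrN; apply: eq_bigr => j _ /=.
by rewrite /dissipation; ring.
Qed.

(** Time 1 is the reference because the differential equations are given at positive times only. *)
Lemma lyapunov_nonincreasing t : 1 <= t -> lyapunov (orbit t) <= lyapunov (orbit 1).
Proof.
move=> t1; have [u|s /andP[s1 st] e] := is_derive_MVT (f := fun t => lyapunov (orbit t))
  (f' := fun t => - \sum_j dissipation (orbit t) j) t1.
  by move=> /andP[u1 _]; apply: is_derive_lyapunov; exact: lt_le_trans u1.
rewrite -subr_le0 e mulNr oppr_le0 mulr_ge0 ?subr_ge0 // sumr_ge0 // => j _.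
exact: dissipation_ge0.
Qed.

Definition box M : set state :=
  [set v : 'cV[R]_n | forall i, `|v i 0| <= M] `*`
  [set v : 'cV[R]_m | forall j, `|v j 0| <= M].

Lemma box_compact M : compact (box M).
Proof. by apply: compact_setX; exact: cV_box_compact. Qed.

Lemma orbit_bounded : exists M, forall t, 1 <= t -> box M (orbit t).
Proof.
have [M HM] := lyapunov_sublevel_bounded (lyapunov (orbit 1)).
by exists M => t /lyapunov_nonincreasing /HM.
Qed.

(** From time 1 on the orbit stays in a compact box, where the continuous vector field is
    bounded. *)
Lemma orbit_lipschitz : exists2 L, 0 < L & forall t s, 1 <= t -> 0 <= s ->
  `|orbit (t + s) - orbit t| <= L * s.
Proof.
have [M HM] := orbit_bounded.
pose speed z := \sum_i `|velocity z i| + \sum_j `|drop z j|.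
have cs : continuous speed.
  apply: continuous_add; apply: continuous_sum => i.
    exact: (continuous_post (@norm_continuous _ R^o) (@continuous_velocity i)).
  exact: (continuous_post (@norm_continuous _ R^o) (@continuous_drop i)).
have [L L0 HL] := compact_norm_bounded (@box_compact M) cs.
exists L => // t s t1 s0; have t0 : 0 < t by exact: lt_le_trans t1.
have {}HL u : t <= u -> speed (orbit u) <= L.
  by move=> tu; apply: le_trans (HL _ (HM _ (le_trans t1 tu))); exact: ler_norm.
have sv z : 0 <= \sum_i `|velocity z i| by exact: sumr_ge0.
have sd z : 0 <= \sum_j `|drop z j| by exact: sumr_ge0.
rewrite prod_normE ge_max /=; apply/andP; split; apply: mx_norm_le => [|i j];
  rewrite ?mulr_ge0 ?(ltW L0) // !mxE ord1.
  have [u tu [_ ->]] := is_derive_increment (is_derive_orbit1 i) t0 s0.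
  rewrite normrM (ger0_norm s0) ler_wpM2r // (le_trans _ (HL u tu)) //.
  by rewrite /speed (bigD1 i) //= -addrA lerDl addr_ge0 ?sumr_ge0.
have [u tu [_ ->]] := is_derive_increment (is_derive_orbit2 i) t0 s0.
rewrite normrM (ger0_norm s0) ler_wpM2r // (le_trans _ (HL u tu)) //.
by rewrite /speed [X in _ + X](bigD1 i) //= addrCA lerDl addr_ge0 ?sumr_ge0.
Qed.

Lemma dissipation_cvg0 j : dissipation (orbit t) j @[t --> +oo] --> (0 : R).
Proof.
have [m0 Hm0] := lyapunov_ge.
have [M HM] := orbit_bounded; have [L L0 HL] := orbit_lipschitz.
have W0 t : 0 <= \sum_j dissipation (orbit t) j.
  by rewrite sumr_ge0 // => l _; exact: dissipation_ge0.
have W : \sum_j dissipation (orbit t) j @[t --> +oo] --> (0 : R).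
  apply: (@barbalat _ (fun t => lyapunov (orbit t)) _ m0) => //.
    by move=> t; exact: is_derive_lyapunov.
  move=> e e0.
  have cW : continuous (fun z => \sum_j dissipation z j).
    by apply: continuous_sum; exact: continuous_dissipation.
  have [r r0 Hr] := compact_uniformly_continuous (@box_compact M) cW e0.
  exists (r / L); first by rewrite divr_gt0.
  move=> t s t1 /andP[s0 sr]; apply: Hr; [apply: HM|exact: HM|].
    by rewrite (le_trans t1) // lerDl.
  by rewrite (le_trans (HL _ _ t1 s0)) // mulrC -ler_pdivlMr.
apply/cvg0_pinftyP => e e0; move/cvg0_pinftyP: W => /(_ _ e0).
apply: filterS => t; apply: le_trans.
rewrite !ger0_norm ?dissipation_ge0 // (bigD1 j) //= lerDl sumr_ge0 // => l _.
exact: dissipation_ge0.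
Qed.

Lemma flow_gap_cvg0 j :
  flow (orbit t) j - integral_flow (orbit t) j @[t --> +oo] --> (0 : R).
Proof.
apply/cvg0_pinftyP => e e0.
move/cvg0_pinftyP: (@dissipation_cvg0 j) => /(_ (e ^+ 2)).
rewrite exprn_gt0 // => /(_ isT).
apply: filterS => t; rewrite ger0_norm ?dissipation_ge0 //.
move=> /(le_trans (flow_gap_sqr _ _)); rewrite -[X in X <= _]real_normK ?num_real //.
by rewrite ler_pXn2r // nnegrE // ltW.
Qed.

(** [clamp] has kinks, so the flow is followed through [clamp_cubic]: the derivative becomes the
    weight times minus the drop, which the vanishing dissipation forces to 0. *)
Lemma slowly_varying_integral_flow j :
  slowly_varying (fun t => integral_flow (orbit t) j).
Proof.
have ab := um_lt_up j; pose q t := integral_flow (orbit t) j.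
apply: (@slowly_varying_clamp_cubic _ (um j 0) (up j 0)).
  by move=> t; exact: clamp_itv.
apply: (@slowly_varying_derive _ _
  (fun t => (q t - um j 0) * (up j 0 - q t) * - drop (orbit t) j)).
  move=> t t0; have dy := is_derive_orbit2 j t0.
  exact: (@is_derive1_comp _ _ (- (fun t => y t j 0)) t _ _
    (is_derive_clamp_cubic (- y t j 0) ab) (is_deriveN dy)).
pose w t := dissipation (orbit t) j.
have w0 : w t @[t --> +oo] --> (0 : R) by exact: dissipation_cvg0.
have : (up j 0 - um j 0) * w t + (up j 0 - um j 0) ^+ 2 * Num.sqrt (w t)
    @[t --> +oo] --> (0 : R).
  rewrite -[X in _ --> X](addr0 0) -{1}(mulr0 (up j 0 - um j 0)).
  rewrite -{2}(mulr0 ((up j 0 - um j 0) ^+ 2)) -{2}(@sqrtr0 R).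
  apply: cvgD; apply: cvgM; try exact: cvg_cst; first exact: w0.
  by apply: continuous_cvg w0; exact: sqrt_continuous.
move=> /cvg0_pinftyP B0; apply/cvg0_pinftyP => e e0; apply: filterS (B0 e e0) => t.
apply: le_trans; apply: le_trans (ler_norm _); rewrite mulrN normrN.
by apply: (clamp_dissipation_weight ab).
Qed.

(** The flow is the integral flow plus a gap that tends to 0, and both vary slowly. *)
Lemma slowly_varying_velocity i : slowly_varying (fun t => velocity (orbit t) i).
Proof.
apply: slowly_varying_sum => j; apply: slowly_varyingZ.
have sg := slowly_varying_cvg0 (@flow_gap_cvg0 j).
have sc : slowly_varying (fun=> c j 0 : R).
  by move=> T e e0; near=> t => s _; rewrite subrr normr0 ltW.
have := slowly_varyingD (slowly_varyingD sg (@slowly_varying_integral_flow j)) sc.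
by apply: slowly_varying_ext => t _; rewrite subrK.
Unshelve. all: by end_near. Qed.

Lemma velocity_cvg0 i : velocity (orbit t) i @[t --> +oo] --> (0 : R).
Proof.
have [M HM] := orbit_bounded.
apply: (@cvg0_derive_slowly_varying _ (fun t => x t i 0) _ M);
  last exact: slowly_varying_velocity.
  by move=> t; exact: is_derive_orbit1.
near=> t; have [xM _] : box M (orbit t) by apply: HM.
exact: xM.
Unshelve. all: by end_near. Qed.

(** The drop depends on [x] alone, continuously, and [x] varies slowly because its velocity tends to
    0. *)
Lemma slowly_varying_drop j : slowly_varying (fun t => drop (orbit t) j).
Proof.
have [M HM] := orbit_bounded.
apply: (@slowly_varying_uniform _ _ (fun i t => x t i 0)); last first.
  by move=> i; apply: slowly_varying_derive (@velocity_cvg0 i); exact: is_derive_orbit1.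
move=> e e0.
have cg := continuous_sub (@continuous_gradient_coord _ _ _ g_diff (Defs.head G j))
  (@continuous_gradient_coord _ _ _ g_diff (Defs.tail G j)).
have [r r0 Hr] := compact_uniformly_continuous (@cV_box_compact _ n M) cg e0.
exists r => // t s t1 s0 xr; apply: Hr.
- have [|] // := HM (t + s); by rewrite (le_trans t1) // lerDl.
- by have [] := HM t t1.
- by apply: mx_norm_le => [|i l]; [exact: ltW|rewrite !mxE ord1; exact: xr].
Qed.

Lemma drop_cvg0 j : drop (orbit t) j @[t --> +oo] --> (0 : R).
Proof.
have [M HM] := orbit_bounded.
apply: (@cvg0_derive_slowly_varying _ (fun t => y t j 0) _ M);
  last exact: slowly_varying_drop.
  by move=> t; exact: is_derive_orbit2.
near=> t; have [_ yM] : box M (orbit t) by apply: HM.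
exact: yM.
Unshelve. all: by end_near. Qed.

(** The residual differs from the velocity only by the image under [B] of the flow gaps. *)
Lemma residual_cvg0 i : residual (orbit t) i @[t --> +oo] --> (0 : R).
Proof.
have gap : \sum_j B i j * (flow (orbit t) j - integral_flow (orbit t) j)
    @[t --> +oo] --> (0 : R).
  apply: cvg0_sum => j; rewrite -(mulr0 (B i j)).
  by apply: cvgM; [exact: cvg_cst|exact: flow_gap_cvg0].
rewrite -[X in _ --> X](subr0 0).
rewrite (_ : (fun t => _) = (fun t => velocity (orbit t) i
  - \sum_j B i j * (flow (orbit t) j - integral_flow (orbit t) j))); last first.
  apply/funext => t; rewrite -sumrB; apply: eq_bigr => j _.
  by rewrite -mulrBr; congr (_ * _); ring.
by apply: cvgB => //; exact: velocity_cvg0.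
Qed.

Lemma orbit_converges : weakly_connected G -> E_tot G um up H E d !=set0 ->
  edist_inf (E_tot G um up H E d) (orbit t) @[t --> +oo] --> 0%E.
Proof.
move=> conn [z0 z0E].
(* On a connected graph [f] vanishes only on the target set, since zero drops along edges make the
   gradient constant. *)
pose f z := \sum_i `|residual z i| + \sum_j `|drop z j|.
have cf : continuous f.
  apply: continuous_add; apply: continuous_sum => i.
    exact: (continuous_post (@norm_continuous _ R^o) (@continuous_residual i)).
  exact: (continuous_post (@norm_continuous _ R^o) (@continuous_drop i)).
have f_cvg : f (orbit t) @[t --> +oo] --> (0 : R).
  rewrite -[X in _ --> X](addr0 0); apply: cvgD.
    apply: cvg0_sum => i; rewrite -(@normr0 _ R); apply: cvg_norm.
    exact: residual_cvg0.
  by apply: cvg0_sum => j; rewrite -(@normr0 _ R); apply: cvg_norm; exact: drop_cvg0.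
have f_gt0 z : ~ E_tot G um up H E d z -> 0 < f z.
  have S0 : 0 <= \sum_i `|residual z i| by exact: sumr_ge0.
  have T0 : 0 <= \sum_j `|drop z j| by exact: sumr_ge0.
  move=> zE; rewrite lt_def addr_ge0 // andbT; apply/eqP => /eqP.
  rewrite paddr_eq0 // => /andP[/eqP r0 /eqP d0]; apply/zE/E_totP; split=> [i|].
    by apply/eqP; rewrite -normr_eq0; apply/eqP; exact: (psumr_eq0P _ r0).
  apply: (weakly_connected_const (w := fun i => gradient H z.1 i 0) conn) => j.
  apply/eqP; rewrite -subr_eq0 -normr_eq0; apply/eqP.
  exact: (psumr_eq0P _ d0).
have [M HM] := orbit_bounded.
have close e : 0 < e ->
    \forall t \near +oo, (edist_inf (E_tot G um up H E d) (orbit t) < e%:E)%E.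
  move=> e0.
  (* On this compact set [f] has a positive lower bound [r], whereas [f] tends to 0 along the orbit,
     so the orbit finally leaves it. *)
  pose far := box M `&` [set z | (e%:E <= edist_inf (E_tot G um up H E d) z)%E].
  have cfar : compact far.
    apply: compact_closedI; first exact: box_compact.
    apply: (@preimage_closed _ _ _ [set r | (e%:E <= r)%E]) => [z _|].
      exact: edist_inf_continuous.
    exact: closed_ereal_le_ereal.
  have [z [_ /= ze]|r r0 Hr] := compact_gt0_lower_bound cfar cf.
    by apply: f_gt0 => zE; move: ze; rewrite (edist_inf0 zE) lee_fin leNgt e0.
  move/cvg0_pinftyP: f_cvg => /(_ _ (divr_gt0 r0 (ltr0n R 2))); apply: filter_app.
  near=> t => ft; rewrite ltNge; apply/negP => te.
  have : r <= f (orbit t) by apply: Hr; split=> //; apply: HM.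
  by have := ler_norm (f (orbit t)); lra.
apply/fine_cvgP; split.
  apply: filterS (close 1 ltr01) => t t1.
  by rewrite ge0_fin_numE ?edist_inf_ge0 // (lt_trans t1) // ltry.
apply/cvg0_pinftyP => e e0; apply: filterS (close e e0) => t te /=.
rewrite ger0_norm ?fine_ge0 ?edist_inf_ge0 // -lee_fin fineK ?ltW //.
by rewrite ge0_fin_numE ?edist_inf_ge0 // (lt_trans te) // ltry.
Unshelve. all: by end_near. Qed.

End ClosedLoopAnalysis.

(** * The equivalence, with a stray equilibrium for disconnected graphs *)

Theorem theorem10 (R : realType) (n m k : nat) (G : digraph n m)
    (um up : 'cV[R]_m) (H : 'cV[R]_n -> R) (E : 'M[R]_(n, k))
    (u_bidir : forall i, um i 0 < 0 < up i 0)
    (H_C2 : twice_continuously_differentiable H)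
    (H_hess : forall x, positive_definite (hessian H x))
    (imEB : range (fun d : 'cV[R]_k => E *m d) `<=`
            range (fun y : 'cV[R]_m => incidence R G *m y))
    (d : 'cV[R]_k)
    (d_ok : exists2 xcbar, permission_set um up xcbar &
              E *m d = incidence R G *m xcbar)
    (Etot_neq0 : E_tot G um up H E d !=set0) :
  trajectories_converge_to G um up H E d (E_tot G um up H E d) <->
  weakly_connected G.
Proof.
have [H_diff g_diff _] := H_C2; have [c cP inflow] := d_ok.
have c_range := permission_opp_range u_bidir cP.
have [[xs ys] xsE] := Etot_neq0; have [[a xs_crit] _] := xsE.
split=> [conv|conn x0 y0 x y [_ _ _ ode]]; last first.
  exact: (orbit_converges H_diff g_diff H_hess c_range inflow xs_crit ode conn).
move=> v w; apply: contrapT => /negP vw.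
have [e e0 He] := gradient_locally_onto H_diff g_diff H_hess xs.
(* Raising the gradient by [e] on the component of [v] alone leaves all drops zero but separates [v]
   from [w]. *)
pose b : 'cV[R]_n := \col_i (if connect (Defs.adjacent G) v i then e else 0).
have [i|x gx] := He b.
  by rewrite mxE; case: ifP => _; rewrite ?normr0 ?ger0_norm // ltW.
pose z := (x, ys).
have gE i : gradient H x i 0 = a + (if connect (Defs.adjacent G) v i then e else 0).
  by rewrite gx xs_crit !mxE.
have adj j : connect (Defs.adjacent G) (Defs.head G j) (Defs.tail G j) /\
             connect (Defs.adjacent G) (Defs.tail G j) (Defs.head G j).
  by split; apply: connect1; apply/existsP; exists j; rewrite !eqxx ?orbT.
have dz j : drop G H z j = 0.
  rewrite /drop !gE; have [ht th] := adj j.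
  suff -> : connect (Defs.adjacent G) v (Defs.head G j) =
            connect (Defs.adjacent G) v (Defs.tail G j).
    by rewrite subrr.
  by apply/idP/idP => h; apply: connect_trans h _.
have [rz _] := (E_totP um up H inflow (xs, ys)).1 xsE.
(* With zero drops the flow equals the integral flow, which depends only on [ys]; the velocity is
   then the residual at the given point of [E_tot]. *)
have rhs : incidence R G *m sat (- ((incidence R G)^T *m gradient H x) - ys) um up
    + E *m d = 0.
  rewrite (field_velocity _ _ _ inflow); apply/matrixP => i j; rewrite !mxE.
  rewrite -(rz i); apply: eq_bigr => l _.
  by rewrite /flow dz subr0.
have rhs2 : (incidence R G)^T *m gradient H x = 0.
  by apply/matrixP => i j; rewrite ord1 incidence_gradient mxE; exact: dz.
have traj : is_trajectory G um up H E d x ys (cst x) (cst ys).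
  split=> //.
  - by apply: continuous_subspaceT => ?; exact: cvg_cst.
  - by apply: continuous_subspaceT => ?; exact: cvg_cst.
  - by move=> t _; rewrite /cst rhs rhs2; split; exact: is_derive_cst.
(* Along the constant trajectory the distance is constant, so its limit 0 is its value. *)
have dist0 : edist_inf (E_tot G um up H E d) z = 0%E.
  have h : edist_inf (E_tot G um up H E d) z @[t --> (+oo : set_system R)] --> 0%E.
    exact: conv traj.
  have := cvg_lim (@ereal_hausdorff R) h.
  by move=> /(_ proper_pinfty_nbhs); rewrite lim_cst; last exact: ereal_hausdorff.
have zE : E_tot G um up H E d z.
  by apply: edist_inf_eq0 dist0; exact: closed_E_tot g_diff c_range inflow.
have [_ /(_ v w)] := (E_totP um up H inflow z).1 zE.
rewrite /= !gE connect0 (negPf vw) => /addrI e1.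
by move: e0; rewrite e1 ltxx.
Qed.
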